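(* Let $\mathcal{A}$ be an abelian category. Then $\mathrm{ASpec}\,\mathcal{A}$, with the localizing topology, has no point that is a limit point of its closure; that is, for every $\alpha\in\mathrm{ASpec}\,\mathcal{A}$, $$\alpha\notin\overline{\overline{\{\alpha\}}\setminus\{\alpha\}}.$$
   Context: In a topological space $X$, a point $x$ is a limit point of a subset $S$ if $x$ belongs to the closure of $S\setminus\{x\}$. Overlines on subsets denote closures. Let $\mathcal{A}$ be an abelian category. A monoform object is a nonzero object $H$ having no subobjects $0\neq L'\subsetneq L\subset H$ and $0\neq N\subset H$ with $L/L'\cong N$. Two monoform objects are atom-equivalent if they have isomorphic nonzero subobjects (an equivalence relation). $\mathrm{ASpec}\,\mathcal{A}$ is the set of equivalence classes $\overline{H}$ of monoform objects. For $M\in\mathcal{A}$, $\mathrm{ASupp}\,M:=\{\overline{H}\mid H\text{ is a monoform subquotient of }M\}$. The localizing topology on $\mathrm{ASpec}\,\mathcal{A}$ is the topology with open basis $\{\mathrm{ASupp}\,M\mid M\in\mathcal{A}\}$. *)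

(* Defs.v *)
From HB Require Import structures.
From mathcomp Require Import all_boot all_order all_algebra generic_quotient.
From mathcomp Require Import all_classical topology.

Set Implicit Arguments.
Unset Strict Implicit.
Unset Printing Implicit Defensive.

Import GRing.Theory.
Local Open Scope quotient_scope.
Local Open Scope classical_set_scope.
Local Open Scope ring_scope.

Record preadditive := Preadditive {
  obj :> Type;
  hom : obj -> obj -> zmodType;
  idm : forall A, hom A A;
  comp : forall A B D, hom B D -> hom A B -> hom A D;
  comp1m : forall A B (f : hom A B), comp (idm B) f = f;
  compm1 : forall A B (f : hom A B), comp f (idm A) = f;
  compA : forall A B D E (h : hom D E) (g : hom B D) (f : hom A B),
    comp h (comp g f) = comp (comp h g) f;
  compDl : forall A B D (g g' : hom B D) (f : hom A B),
    comp (g + g') f = comp g f + comp g' f;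
  compDr : forall A B D (g : hom B D) (f f' : hom A B),
    comp g (f + f') = comp g f + comp g f'
}.
Arguments hom {p} A B.
Arguments idm {p} A.
Arguments comp {p A B D} g f.

Reserved Notation "g \oc f" (at level 40, left associativity).
Notation "g \oc f" := (comp g f) : ring_scope.

Section Notions.
Context {C : preadditive}.
Implicit Types (A B D E : C).

Definition mono A B (f : hom A B) :=
  forall X (u v : hom X A), f \oc u = f \oc v -> u = v.

Definition epi A B (f : hom A B) :=
  forall X (u v : hom B X), u \oc f = v \oc f -> u = v.

Definition is_iso A B (f : hom A B) :=
  exists g : hom B A, g \oc f = idm A /\ f \oc g = idm B.

Definition isomorphic A B := exists f : hom A B, is_iso f.

(** The zero morphisms provide existence in both universal properties. *)
Definition is_zero A :=
  (forall X (f : hom A X), f = 0) /\ (forall X (f : hom X A), f = 0).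

Definition is_kernel A B K (f : hom A B) (k : hom K A) :=
  f \oc k = 0 /\
  forall X (u : hom X A), f \oc u = 0 -> exists! v : hom X K, k \oc v = u.

Definition is_cokernel A B Q (f : hom A B) (q : hom B Q) :=
  q \oc f = 0 /\
  forall X (u : hom B X), u \oc f = 0 -> exists! v : hom Q X, v \oc q = u.

Definition is_biproduct A B P
    (i1 : hom A P) (i2 : hom B P) (p1 : hom P A) (p2 : hom P B) :=
  [/\ p1 \oc i1 = idm A, p2 \oc i2 = idm B, p1 \oc i2 = 0, p2 \oc i1 = 0
    & i1 \oc p1 + i2 \oc p2 = idm P].

End Notions.

Record is_abelian (C : preadditive) : Prop := IsAbelian {
  has_zero : exists Z : C, is_zero Z;
  has_biproducts : forall A B : C,
    exists P (i1 : hom A P) (i2 : hom B P) (p1 : hom P A) (p2 : hom P B),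
      is_biproduct i1 i2 p1 p2;
  has_kernels : forall (A B : C) (f : hom A B),
    exists K (k : hom K A), is_kernel f k;
  has_cokernels : forall (A B : C) (f : hom A B),
    exists Q (q : hom B Q), is_cokernel f q;
  mono_normal : forall (A B : C) (f : hom A B), mono f ->
    exists D (g : hom B D), is_kernel g f;
  epi_conormal : forall (A B : C) (f : hom A B), epi f ->
    exists D (g : hom D A), is_cokernel g f
}.

Record abelianCat := AbelianCat {
  abelianCat_base :> preadditive;
  abelianCatP : is_abelian abelianCat_base
}.

Section Monoform.
Context {C : abelianCat}.
Implicit Types (H L M N : C).

(** Subobjects are represented by monomorphisms; the quotient [L/L'] is the
    target of a cokernel of the inclusion of [L'] into [L]. *)
Definition is_quotient L' L (l' : hom L' L) (Q : C) :=
  exists q : hom L Q, is_cokernel l' q.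

Definition monoform H :=
  ~ is_zero H /\
  ~ exists (L' L N Q : C) (l' : hom L' L) (l : hom L H) (n : hom N H),
      [/\ mono l' /\ mono l, ~ is_zero L' /\ ~ is_iso l',
          mono n /\ ~ is_zero N, is_quotient l' Q & isomorphic Q N].

Definition subquotient M H :=
  exists (L' L Q : C) (l' : hom L' L) (l : hom L M),
    [/\ mono l', mono l, is_quotient l' Q & isomorphic H Q].

Definition atom_equivalent H1 H2 :=
  exists (L1 L2 : C) (l1 : hom L1 H1) (l2 : hom L2 H2),
    [/\ mono l1 /\ ~ is_zero L1, mono l2 /\ ~ is_zero L2 & isomorphic L1 L2].

End Monoform.

Section CategoryFacts.
Context {C : abelianCat}.
Implicit Types (A B D E H K L M N P Q X : C).

Lemma comp0l A B D (f : hom A B) : (0 : hom B D) \oc f = 0.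
Proof. by apply: (@addrI _ (0 \oc f)); rewrite -compDl !addr0. Qed.

Lemma comp0r A B D (g : hom B D) : g \oc (0 : hom A B) = 0.
Proof. by apply: (@addrI _ (g \oc 0)); rewrite -compDr !addr0. Qed.

Lemma compNl A B D (g : hom B D) (f : hom A B) : (- g) \oc f = - (g \oc f).
Proof. by apply: (@addrI _ (g \oc f)); rewrite -compDl !subrr comp0l. Qed.

Lemma compNr A B D (g : hom B D) (f : hom A B) : g \oc (- f) = - (g \oc f).
Proof. by apply: (@addrI _ (g \oc f)); rewrite -compDr !subrr comp0r. Qed.

Lemma mono0P A B (f : hom A B) :
  (forall X (u : hom X A), f \oc u = 0 -> u = 0) -> mono f.
Proof.
move=> f0 X u v e; apply/eqP; rewrite -subr_eq0; apply/eqP/f0.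
by rewrite compDr compNr e subrr.
Qed.

Lemma mono0 A B X (f : hom A B) (u : hom X A) : mono f -> f \oc u = 0 -> u = 0.
Proof. by move=> fm fu; apply: fm; rewrite comp0r. Qed.

Lemma epi0P A B (f : hom A B) :
  (forall X (u : hom B X), u \oc f = 0 -> u = 0) -> epi f.
Proof.
move=> f0 X u v e; apply/eqP; rewrite -subr_eq0; apply/eqP/f0.
by rewrite compDl compNl e subrr.
Qed.

Lemma epi0 A B X (f : hom A B) (u : hom B X) : epi f -> u \oc f = 0 -> u = 0.
Proof. by move=> fe uf; apply: fe; rewrite comp0l. Qed.

Lemma mono_id A : mono (idm A).
Proof. by move=> X u v; rewrite !comp1m. Qed.

Lemma mono_comp A B D (g : hom B D) (f : hom A B) :
  mono g -> mono f -> mono (g \oc f).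
Proof. by move=> gm fm X u v; rewrite -!compA => /gm/fm. Qed.

Lemma epi_comp A B D (g : hom B D) (f : hom A B) :
  epi g -> epi f -> epi (g \oc f).
Proof. by move=> ge fe X u v; rewrite !compA => /fe/ge. Qed.

Lemma iso_mono A B (f : hom A B) : is_iso f -> mono f.
Proof.
move=> [g [gf _]] X u v /(congr1 (fun h => g \oc h)).
by rewrite !compA gf !comp1m.
Qed.

Lemma iso_epi A B (f : hom A B) : is_iso f -> epi f.
Proof.
move=> [g [_ fg]] X u v /(congr1 (fun h => h \oc g)).
by rewrite -!compA fg !compm1.
Qed.

Lemma iso_refl A : isomorphic A A.
Proof. by exists (idm A), (idm A); rewrite comp1m. Qed.

Lemma iso_sym A B : isomorphic A B -> isomorphic B A.
Proof. by move=> [f [g [gf fg]]]; exists g, f. Qed.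

Lemma zeroP A : is_zero A <-> idm A = 0.
Proof.
split=> [[] // | A0]; split=> X f.
  by rewrite -[f]compm1 A0 comp0r.
by rewrite -[f]comp1m A0 comp0l.
Qed.

Lemma kernel_mono A B K (f : hom A B) (k : hom K A) : is_kernel f k -> mono k.
Proof.
move=> [fk kU] X u v e.
have [|w [_ wU]] := kU X (k \oc u); first by rewrite compA fk comp0l.
by rewrite -(wU u)// -(wU v).
Qed.

Lemma cokernel_epi A B Q (f : hom A B) (q : hom B Q) : is_cokernel f q -> epi q.
Proof.
move=> [qf qU] X u v e.
have [|w [_ wU]] := qU X (u \oc q); first by rewrite -compA qf comp0r.
by rewrite -(wU u)// -(wU v).
Qed.

Lemma epi_cokernel A B K (f : hom A B) (k : hom K A) :
  epi f -> is_kernel f k -> is_cokernel k f.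
Proof.
move=> fe [fk kU]; split=> // X u uk.
have [D [g [fg gU]]] := epi_conormal (abelianCatP C) fe.
have [w [kw _]] := kU _ _ fg.
by apply: gU; rewrite -kw compA uk comp0l.
Qed.

Lemma subquotientP M H :
  subquotient M H <->
  exists L (l : hom L M) (q : hom L H), mono l /\ epi q.
Proof.
split.
  move=> [L' [L [Q [l' [l [_ lm [q /cokernel_epi qe]]]]]]] /iso_sym [f fi].
  by exists L, l, (f \oc q); split=> //; apply: epi_comp (iso_epi fi) qe.
move=> [L [l [q [lm qe]]]].
have [K [k kk]] := has_kernels (abelianCatP C) q.
exists K, L, H, k, l; split=> //; first exact: kernel_mono kk.
  by exists q; apply: epi_cokernel.
exact: iso_refl.
Qed.

Lemma subquotient_sub M H L (l : hom L H) :
  mono l -> subquotient M H -> subquotient M L.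
Proof.
move=> lm /subquotientP [E [m [q [mm qe]]]].
have [P [i1 [i2 [p1 [p2 [p1i1 p2i2 p1i2 p2i1 i1p1]]]]]] :=
  has_biproducts (abelianCatP C) E L.
pose f := q \oc p1 - l \oc p2.
have fi1 : f \oc i1 = q.
  by rewrite /f compDl compNl -!compA p1i1 p2i1 comp0r subr0 compm1.
have fe : epi f.
  by apply: epi0P => X u uf; apply: (epi0 qe); rewrite -fi1 compA uf comp0l.
have [K [k kk]] := has_kernels (abelianCatP C) f.
have [_ fU] := epi_cokernel fe kk.
have /eqP : f \oc k = 0 by case: kk.
rewrite /f compDl compNl subr_eq0 -!compA => /eqP qk.
apply/subquotientP; exists K, (m \oc (p1 \oc k)), (p2 \oc k); split.
  apply: mono_comp => //; apply: mono0P => X u p1ku.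
  apply: (mono0 (kernel_mono kk)); rewrite -[k]comp1m -i1p1 !compDl.
  rewrite -!compA [p1 \oc _]compA p1ku comp0r add0r.
  suff -> : p2 \oc (k \oc u) = 0 by rewrite comp0r.
  by apply: (mono0 lm); rewrite compA compA -[l \oc _ \oc _]compA -qk -!compA
    [p1 \oc _]compA p1ku comp0r.
apply: epi0P => X u upk.
have [|v [vf _]] := fU X (u \oc p2); first by rewrite -compA.
suff v0 : v = 0.
  by rewrite -[u]compm1 -p2i2 compA -vf v0 !comp0l.
by apply: (epi0 qe); rewrite -fi1 compA vf -compA p2i1 comp0r.
Qed.

Lemma subquotient_trans M N H :
  subquotient M N -> subquotient N H -> subquotient M H.
Proof.
move=> sMN /subquotientP [L [l [q [lm qe]]]].
have /subquotientP [E [m [r [mm re]]]] := subquotient_sub lm sMN.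
by apply/subquotientP; exists E, m, (q \oc r); split=> //; apply: epi_comp.
Qed.

Lemma subquotient_refl M : subquotient M M.
Proof.
apply/subquotientP; exists M, (idm M), (idm M); split; first exact: mono_id.
by move=> X u v; rewrite !compm1.
Qed.

Lemma monoform_sub H L (l : hom L H) :
  mono l -> ~ is_zero L -> monoform H -> monoform L.
Proof.
move=> lm L0 [_ Hm]; split=> // -[K' [K [N [Q [k' [k [n]]]]]]].
move=> [[k'm km] K'0 [nm N0] kQ QN]; apply: Hm.
exists K', K, N, Q, k', (l \oc k), (l \oc n).
by split=> //; split=> //; apply: mono_comp.
Qed.

Lemma monoform_uniform H L L' (l : hom L H) (l' : hom L' H) :
  monoform H -> mono l -> mono l' -> ~ is_zero L -> ~ is_zero L' ->
  exists K (k : hom K L) (k' : hom K L'), [/\ mono k, mono k' & ~ is_zero K].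
Proof.
move=> [_ Hm] lm l'm L0 L'0.
have [P [i1 [i2 [p1 [p2 [p1i1 p2i2 p1i2 p2i1 i1p1]]]]]] :=
  has_biproducts (abelianCatP C) L L'.
pose f := l \oc p1 - l' \oc p2.
have [K [k kk]] := has_kernels (abelianCatP C) f.
have km := kernel_mono kk.
have /eqP : f \oc k = 0 by case: kk.
rewrite /f compDl compNl subr_eq0 -!compA => /eqP lk.
have k0 X (u : hom X K) : p1 \oc k \oc u = 0 -> p2 \oc k \oc u = 0 -> u = 0.
  move=> u1 u2; apply: (mono0 km); rewrite -[k]comp1m -i1p1 !compDl.
  by rewrite -!compA [p1 \oc _]compA [p2 \oc _]compA u1 u2 !comp0r addr0.
have [/zeroP K0|K0] := pselect (is_zero K); last first.
  exists K, (p1 \oc k), (p2 \oc k); split=> //; apply: mono0P => X u ku.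
    apply: k0 => //; apply: (mono0 l'm).
    by rewrite compA -lk -compA ku comp0r.
  apply: k0 => //; apply: (mono0 lm).
  by rewrite compA lk -compA ku comp0r.
case: Hm; exists L', P, L, L, i2, f, l.
split=> //; last exact: iso_refl.
- split; first by apply: mono0P => X u iu; rewrite -[u]comp1m -p2i2 -compA iu comp0r.
  apply: mono0P => X u fu; case: kk => _ /(_ _ _ fu) [v [<- _]].
  by rewrite -[v]comp1m K0 comp0l comp0r.
- split=> // /iso_epi i2e; apply/L0/zeroP.
  by rewrite -p1i1 (epi0 i2e p1i2) comp0l.
- exists p1; split=> // X u ui2; exists (u \oc i1); split.
    by rewrite -[RHS]compm1 -i1p1 compDr [u \oc (i2 \oc _)]compA ui2 comp0l
      addr0 compA.
  by move=> v <-; rewrite -compA p1i1 compm1.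
Qed.

Lemma atom_equivalentP H1 H2 :
  atom_equivalent H1 H2 <->
  exists L (l1 : hom L H1) (l2 : hom L H2),
    [/\ mono l1, mono l2 & ~ is_zero L].
Proof.
split.
  move=> [L1 [L2 [l1 [l2 [[m1 n1] [m2 n2] [f fi]]]]]].
  exists L1, l1, (l2 \oc f); split=> //.
  exact: mono_comp m2 (iso_mono fi).
move=> [L [l1 [l2 [m1 m2 L0]]]]; exists L, L, l1, l2.
by split=> //; exact: iso_refl.
Qed.

Lemma atom_equivalent_refl H : ~ is_zero H -> atom_equivalent H H.
Proof.
move=> H0; apply/atom_equivalentP; exists H, (idm H), (idm H).
by split=> //; apply: mono_id.
Qed.

Lemma atom_equivalent_sym H1 H2 : atom_equivalent H1 H2 -> atom_equivalent H2 H1.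
Proof.
move=> /atom_equivalentP [L [l1 [l2 [? ? ?]]]].
by apply/atom_equivalentP; exists L, l2, l1.
Qed.

Lemma atom_equivalent_trans H1 H2 H3 : monoform H2 ->
  atom_equivalent H1 H2 -> atom_equivalent H2 H3 -> atom_equivalent H1 H3.
Proof.
move=> H2m /atom_equivalentP [L [l1 [l2 [m1 m2 L0]]]].
move=> /atom_equivalentP [L' [l2' [l3 [m2' m3 L'0]]]].
have [K [k [k' [km k'm K0]]]] := monoform_uniform H2m m2 m2' L0 L'0.
apply/atom_equivalentP; exists K, (l1 \oc k), (l3 \oc k').
by split=> //; apply: mono_comp.
Qed.

End CategoryFacts.

Record monoformObj (C : abelianCat) := MonoformObj {
  monoform_val :> C;
  monoformP : monoform monoform_val
}.

HB.instance Definition _ (C : abelianCat) := gen_eqMixin (monoformObj C).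
HB.instance Definition _ (C : abelianCat) := gen_choiceMixin (monoformObj C).

Section ASpec.
Context {C : abelianCat}.

Definition atom_eq (H1 H2 : monoformObj C) : bool := `[< atom_equivalent H1 H2 >].

Lemma atom_eq_refl : reflexive atom_eq.
Proof. by move=> H; apply/asboolP/atom_equivalent_refl; case: (monoformP H). Qed.

Lemma atom_eq_sym : symmetric atom_eq.
Proof. by move=> H1 H2; apply/asbool_equiv_eq; split=> /atom_equivalent_sym. Qed.

Lemma atom_eq_trans : transitive atom_eq.
Proof.
move=> H2 H1 H3 /asboolP e12 /asboolP e23; apply/asboolP.
exact: atom_equivalent_trans (monoformP H2) e12 e23.
Qed.

Canonical atom_equiv_rel := EquivRel atom_eq atom_eq_refl atom_eq_sym atom_eq_trans.

End ASpec.

Definition ASpec (C : abelianCat) : Type := {eq_quot @atom_equiv_rel C}.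

HB.instance Definition _ (C : abelianCat) :=
  Choice.copy (ASpec C) {eq_quot @atom_equiv_rel C}.

Definition atom (C : abelianCat) (H : monoformObj C) : ASpec C :=
  \pi_{eq_quot @atom_equiv_rel C} H.

Lemma atomP (C : abelianCat) (H1 H2 : monoformObj C) :
  atom H1 = atom H2 <-> atom_equivalent H1 H2.
Proof.
split=> [e | e]; last by apply/eqmodP/asboolP.
by apply/asboolP; apply/(@eqmodP _ (@atom_equiv_rel C)).
Qed.

Lemma atom_surj (C : abelianCat) (a : ASpec C) : exists H, a = atom H.
Proof. by exists (repr a); rewrite /atom reprK. Qed.

Definition ASupp (C : abelianCat) (M : C) : set (ASpec C) :=
  [set a | exists H : monoformObj C, subquotient M H /\ a = atom H].

Section LocalizingTopology.
Context {C : abelianCat}.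

Lemma ASupp_cover : \bigcup_(U in range (@ASupp C)) U = setT.
Proof.
rewrite predeqE => a; split=> // _; have [H ->] := atom_surj a.
by exists (ASupp H); [exists H | exists H; split=> //; apply: subquotient_refl].
Qed.

Lemma ASupp_join (U V : set (ASpec C)) (a : ASpec C) :
  range (@ASupp C) U -> range (@ASupp C) V -> U a -> V a ->
  exists W, [/\ range (@ASupp C) W, W a & W `<=` U `&` V].
Proof.
move=> [M _ <-] [N _ <-] [H [MH ->]] [H' [NH' /atomP]].
move=> /atom_equivalentP [L [l [l' [lm l'm L0]]]].
have Lm := monoform_sub lm L0 (monoformP H).
exists (ASupp L); split; first by exists L.
  exists (MonoformObj Lm); split; first exact: subquotient_refl.
  apply/atomP/atom_equivalentP; exists L, l, (idm L).
  by split=> //; apply: mono_id.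
move=> _ [G [LG ->]]; split; exists G; split=> //.
  exact: subquotient_trans (subquotient_sub lm MH) LG.
exact: subquotient_trans (subquotient_sub l'm NH') LG.
Qed.

End LocalizingTopology.

HB.instance Definition _ (C : abelianCat) :=
  @isBaseTopological.Build (ASpec C) (set (ASpec C))
    (range (@ASupp C)) id (@ASupp_cover C) (@ASupp_join C).

Lemma open_ASupp (C : abelianCat) (M : C) : open (ASupp M).
Proof.
exists [set ASupp M]; first by move=> _ ->; exists M.
by rewrite bigcup_set1.
Qed.

(* Main.v *)
Require Import Defs.
From mathcomp Require Import all_boot all_order all_algebra.
From mathcomp Require Import all_classical topology.
Local Open Scope classical_set_scope.

(** Let [alpha] be the class of a monoform object [H].  The neighbourhood
    [ASupp H] of [alpha] meets the closure of [alpha] only in [alpha].  Indeed, a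
    point of the intersection is the class of a monoform [G = E/K] with [E] a
    subobject of [H], and [alpha] belongs to [ASupp G].  Hence some nonzero
    subobject [L] of [H] is a subquotient of [G], say [L = P/K'] with
    [K <= K' < P <= E].  As [H] is monoform, [K' = 0], so [K = 0] and [G = E] is a
    subobject of [H]. *)

Set Implicit Arguments.
Unset Strict Implicit.
Unset Printing Implicit Defensive.

Import GRing.Theory.

Section SubquotientsOfMonoforms.
(** [all_algebra] shadows [hom]. *)
Import Defs.
Context {C : abelianCat}.
Implicit Types (E F G H L : C).

Local Open Scope ring_scope.

(** The pullback is the kernel of [q \oc s1 - l \oc s2] on the biproduct. This map restricts to [q]
    on [E], so it is epi and is the cokernel of its kernel. *)
Lemma epi_pullback E F G (q : hom E G) (l : hom F G) : epi q ->
  exists P (p1 : hom P E) (p2 : hom P F), [/\ q \oc p1 = l \oc p2, epi p2,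
    (forall X (u : hom X P), p1 \oc u = 0 -> p2 \oc u = 0 -> u = 0) &
    forall X (u : hom X E) (v : hom X F), q \oc u = l \oc v ->
      exists w, p1 \oc w = u /\ p2 \oc w = v].
Proof.
move=> qe.
have [S [i1 [i2 [s1 [s2 [s1i1 s2i2 s1i2 s2i1 is1]]]]]] :=
  has_biproducts (abelianCatP C) E F.
pose f := q \oc s1 - l \oc s2.
have fi1 : f \oc i1 = q.
  by rewrite /f compDl compNl -!compA s1i1 s2i1 comp0r subr0 compm1.
have fe : epi f.
  by apply: epi0P => X u uf; apply: (epi0 qe); rewrite -fi1 compA uf comp0l.
have [P [p pk]] := has_kernels (abelianCatP C) f.
have [_ fU] := epi_cokernel fe pk.
have [fp pU] := pk.
exists P, (s1 \oc p), (s2 \oc p); split.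
- by apply/eqP; rewrite !compA -subr_eq0 -compNl -compDl fp.
- apply: epi0P => X u upk.
  (* [u \oc s2] kills [p], so it equals [v \oc f]; it vanishes on the summand [E], whence
     [v \oc q = 0]. *)
  have [|v [vf _]] := fU X (u \oc s2); first by rewrite -compA.
  have v0 : v = 0.
    by apply: (epi0 qe); rewrite -fi1 compA vf -compA s2i1 comp0r.
  by rewrite -[u]compm1 -s2i2 compA -vf v0 !comp0l.
- move=> X u u1 u2; apply: (mono0 (kernel_mono pk)).
  rewrite -[p]comp1m -is1 !compDl -!compA.
  by rewrite [s1 \oc _]compA u1 [s2 \oc _]compA u2 !comp0r addr0.
- move=> X u v quv.
  have [|w [pw _]] := pU X (i1 \oc u + i2 \oc v).
    rewrite compDr compA fi1 /f compDl compNl -!compA [s1 \oc _]compA s1i2.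
    by rewrite [s2 \oc _]compA s2i2 comp0l comp0r comp1m add0r quv subrr.
  exists w; split; rewrite -compA pw compDr !compA.
    by rewrite s1i1 s1i2 comp0l comp1m addr0.
  by rewrite s2i1 s2i2 comp0l comp1m add0r.
Qed.

Lemma monoform_quotient_mono H E G L (m : hom E H) (q : hom E G) (n : hom L H) :
  monoform H -> mono m -> epi q -> mono n -> ~ is_zero L -> subquotient G L ->
  mono q.
Proof.
move=> [_ Hm] mm qe nm L0 /subquotientP [F [l [r [lm re]]]].
(* [P] is the preimage in [E] of the subobject [F] of [G]; it maps onto [L], with kernel [K']. *)
have [P [p1 [p2 [qp p2e pj pU]]]] := epi_pullback l qe.
have p1m : mono p1.
  apply: mono0P => X u u1; apply: pj => //; apply: (mono0 lm).
  by rewrite compA -qp -compA u1 comp0r.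
have ce := epi_comp re p2e.
have [K' [k' k'k]] := has_kernels (abelianCatP C) (r \oc p2).
have [ck' k'U] := k'k.
have /zeroP K'0 : is_zero K'.
  (* The quotient [P/K'] is a copy of the subobject [L] of [H], and [K'] is proper because [L] is
     nonzero. *)
  apply: contrapT => K'0; apply: Hm.
  exists K', P, L, L, k', (m \oc p1), n; split=> //; last exact: iso_refl.
  - by split; [exact: kernel_mono k'k | exact: mono_comp].
  - split=> // /iso_epi k'e; apply/L0/zeroP/(epi0 ce).
    by rewrite (epi0 k'e ck') comp0r.
  - by exists (r \oc p2); apply: epi_cokernel.
(* A map killed by [q] lifts to [P] with zero component in [F], so it factors through [K']. *)
apply: mono0P => X u qu.
have [|w [<- p2w]] := pU X u 0; first by rewrite qu comp0r.
have [|v [<- _]] := k'U X w; first by rewrite -compA p2w comp0r.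
by rewrite -[v]comp1m K'0 comp0l !comp0r.
Qed.

Lemma monoform_subquotient_atom_equivalent H G L (n : hom L H) :
  monoform H -> monoform G -> mono n -> ~ is_zero L ->
  subquotient H G -> subquotient G L -> atom_equivalent G H.
Proof.
move=> Hm [G0 _] nm L0 /subquotientP [E [m [q [mm qe]]]] GL.
have qm := monoform_quotient_mono Hm mm qe nm L0 GL.
apply/atom_equivalentP; exists E, q, m; split=> // -[E0 _].
by apply/G0/zeroP/(epi0 qe); rewrite comp1m; apply: E0.
Qed.

(** [ASupp G] is an open neighbourhood of [atom G], so it meets the singleton. *)
Lemma closure_ASupp (H G : monoformObj C) :
  closure [set atom H] (atom G) -> ASupp G (atom H).
Proof.
case/(_ (ASupp G)); last by move=> _ [->].
apply: open_nbhs_nbhs; split; first exact: open_ASupp.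
by exists G; split=> //; exact: subquotient_refl.
Qed.

Lemma closure_atom_ASupp (H : monoformObj C) :
  closure [set atom H] `&` ASupp H `<=` [set atom H].
Proof.
move=> _ [/[swap] -[G [HG ->]]] /closure_ASupp [H1 [GH1 /atomP]].
(* The common subobject [L] of [H] and [H1] is a subquotient of [G] through [H1]. *)
move=> /atom_equivalentP [L [n [l [nm lm L0]]]].
apply/atomP; apply: (monoform_subquotient_atom_equivalent _ _ nm L0 HG) => //.
- exact: monoformP.
- exact: monoformP.
- exact: subquotient_sub lm GH1.
Qed.

End SubquotientsOfMonoforms.

Theorem proposition5p5 (C : abelianCat) (alpha : ASpec C) :
  ~ closure (closure [set alpha] `\ alpha) alpha.
Proof.
have [H ->] := atom_surj alpha.
case/(_ (ASupp H)).
  apply: open_nbhs_nbhs; split; first exact: open_ASupp.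
  by exists H; split=> //; exact: subquotient_refl.
by move=> b [[bcl bH] bS]; apply/bH/closure_atom_ASupp.
Qed.
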